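(* (a) Every local (pre)sheaf structure is a model of intuitionistic logic. (b) Every uniform (pre)sheaf structure is a model of intuitionistic logic.
   Context: Let $B$ be a topological space and $D$ a nonempty set (the domain of discourse). A sheaf-valued structure assigns to each formula $\alpha$ with $n$ parameters a sheaf $|\alpha|$ over $B$ depending on $n$ variables ranging over $D$ (logical variables being interpreted by arbitrary such families of sheaves), with the connectives interpreted by: $|\alpha\lor\beta|=|\alpha|\sqcup|\beta|$ (coproduct of sheaves), $|\alpha\land\beta|=|\alpha|\times|\beta|$ (product of sheaves), $|\alpha\to\beta|=\mathrm{Hom}(|\alpha|,|\beta|)$ (the sheaf of germs of sheaf morphisms), $|\bot|$ = the empty sheaf (characteristic sheaf of the empty open set), $|\exists x\,\alpha(x)|=\bigsqcup_{d\in D}|\alpha|(d)$, $|\forall x\,\alpha(x)|=\prod_{d\in D}|\alpha|(d)$. A presheaf structure is defined in the same way using the corresponding operations (product, coproduct, Hom) on presheaves over $B$. A local (pre)sheaf structure is such a structure in which validity $\vDash\alpha$ is defined to mean: every $b\in B$ has a neighborhood $U$ such that $|\alpha|_\mu$ has a section over $U$ for each variable assignment $\mu$ (for parameterless $\alpha$ this says the support of $|\alpha|$ is all of $B$). A uniform (pre)sheaf structure is such a structure in which $B$ is moreover a uniform space and $\vDash\alpha$ means: there exists a uniform cover $\{U_\iota\}$ of $B$ such that $|\alpha|_\mu$ has a section over each $U_\iota$ for each variable assignment $\mu$. A structure is a model of intuitionistic logic if all primary laws of a deductive system for first-order intuitionistic logic are satisfied in it (all instances valid) and the conclusion of each inference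 rule is a semantic consequence of its premisses. *)

(* Defs.v *)
From Stdlib Require List.
From mathcomp Require Import all_boot.
From mathcomp Require Import all_classical.
From mathcomp Require Import topology.

Set Implicit Arguments.
Unset Strict Implicit.
Unset Printing Implicit Defensive.

Local Open Scope classical_set_scope.

(* Pure predicate language. De Bruijn indices stand for the individual
   variables: in [All a] and [Ex a] index 0 of [a] is the bound variable.
   [Atom k p x] is the [k]-ary predicate variable number [p] applied to the
   variables [x]. *)
Inductive form : Type :=
| Atom (k p : nat) of k.-tuple nat
| Bot
| And of form & form
| Or of form & form
| Imp of form & form
| All of form
| Ex of form.

Definition scons {T : Type} (t : T) (f : nat -> T) (n : nat) : T :=
  if n is m.+1 then f m else t.

Fixpoint rename (r : nat -> nat) (a : form) : form :=
  match a with
  | Atom k p x => Atom p (map_tuple r x)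
  | Bot => Bot
  | And b c => And (rename r b) (rename r c)
  | Or b c => Or (rename r b) (rename r c)
  | Imp b c => Imp (rename r b) (rename r c)
  | All b => All (rename (scons 0 (S \o r)) b)
  | Ex b => Ex (rename (scons 0 (S \o r)) b)
  end.

(* [a(t)], where [a(x)] has its distinguished variable [x] at index 0. *)
Definition inst (t : nat) (a : form) : form := rename (scons t id) a.

(* [a] regarded as a formula in which the variable 0 does not occur. *)
Definition shift (a : form) : form := rename S a.

Inductive law : form -> Prop :=
| law_K a b : law (Imp a (Imp b a))
| law_S a b c :
    law (Imp (Imp a (Imp b c)) (Imp (Imp a b) (Imp a c)))
| law_andl a b : law (Imp (And a b) a)
| law_andr a b : law (Imp (And a b) b)
| law_andI a b : law (Imp a (Imp b (And a b)))
| law_orl a b : law (Imp a (Or a b))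
| law_orr a b : law (Imp b (Or a b))
| law_orE a b c :
    law (Imp (Imp a c) (Imp (Imp b c) (Imp (Or a b) c)))
| law_bot a : law (Imp Bot a)
| law_all a t : law (Imp (All a) (inst t a))
| law_ex a t : law (Imp (inst t a) (Ex a)).

(* [rule ps c]: from the premisses [ps] infer the conclusion [c]. *)
Inductive rule : seq form -> form -> Prop :=
| rule_mp a b : rule [:: a; Imp a b] b
| rule_all a c : rule [:: Imp (shift c) a] (Imp c (All a))
| rule_ex a c : rule [:: Imp a (shift c)] (Imp (Ex a) c).

Record structure (D : Type) := Structure {
  obj : Type;
  sbot : obj;
  sand : obj -> obj -> obj;
  sor : obj -> obj -> obj;
  simp : obj -> obj -> obj;
  sall : (D -> obj) -> obj;
  sex : (D -> obj) -> obj;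
  (* validity of a family of objects indexed by variable assignments *)
  svalid : ((nat -> D) -> obj) -> Prop
}.

Definition valuation (D : Type) (M : structure D) : Type :=
  forall k : nat, nat -> k.-tuple D -> obj M.

Fixpoint interp (D : Type) (M : structure D) (v : valuation M)
    (a : form) (mu : nat -> D) : obj M :=
  match a with
  | Atom k p x => v k p (map_tuple mu x)
  | Bot => sbot M
  | And b c => sand (interp v b mu) (interp v c mu)
  | Or b c => sor (interp v b mu) (interp v c mu)
  | Imp b c => simp (interp v b mu) (interp v c mu)
  | All b => sall (fun d => interp v b (scons d mu))
  | Ex b => sex (fun d => interp v b (scons d mu))
  end.

Definition holds (D : Type) (M : structure D) (v : valuation M)
  (a : form) : Prop := svalid (interp v a).

Definition is_model (D : Type) (M : structure D) : Prop :=
  (forall (v : valuation M) (a : form), law a -> holds v a) /\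
  (forall (v : valuation M) (ps : seq form) (c : form), rule ps c ->
     List.Forall (holds v) ps -> holds v c).

Record opens (B : topologicalType) := Opens {
  oset : B -> Prop;
  oset_open : open (oset : set B)
}.
Coercion oset : opens >-> Funclass.

Definition osub (B : topologicalType) (V U : opens B) : Prop :=
  forall x, V x -> U x.

Lemma osub_refl (B : topologicalType) (U : opens B) : osub U U.
Proof. by []. Qed.

Lemma osub_trans (B : topologicalType) (V U W : opens B) :
  osub U V -> osub V W -> osub U W.
Proof. by move=> UV VW x /UV/VW. Qed.

Definition opensI (B : topologicalType) (U V : opens B) : opens B :=
  Opens (openI (oset_open U) (oset_open V)).

Lemma osubIl (B : topologicalType) (U V : opens B) : osub (opensI U V) U.
Proof. by move=> x []. Qed.

Lemma osubIr (B : topologicalType) (U V : opens B) : osub (opensI U V) V.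
Proof. by move=> x []. Qed.

Arguments osub_refl {B} U x _.
Arguments osub_trans {B V U W} _ _ x _.
Arguments osubIl {B} U V x _.
Arguments osubIr {B} U V x _.

Definition opens0 (B : topologicalType) : opens B := Opens (@open0 B).

Record presheaf (B : topologicalType) := Presheaf {
  sec :> opens B -> Type;
  res : forall U V : opens B, osub V U -> sec U -> sec V;
  res_id : forall (U : opens B) (h : osub U U) (s : sec U), res h s = s;
  res_comp : forall (U V W : opens B) (h : osub V U) (k : osub W V)
    (l : osub W U) (s : sec U), res k (res h s) = res l s
}.
Arguments res {B} p {U V} h s.
Arguments res_id {B} p {U} h s.
Arguments res_comp {B} p {U V W} h k l s.

Definition is_sheaf (B : topologicalType) (F : presheaf B) : Prop :=
  forall (I : Type) (U : opens B) (U_ : I -> opens B)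
    (hU : forall i, osub (U_ i) U),
  (forall x, U x -> exists i, U_ i x) ->
  forall s : forall i, F (U_ i),
  (forall i j, res F (osubIl (U_ i) (U_ j)) (s i) =
               res F (osubIr (U_ i) (U_ j)) (s j)) ->
  exists! t : F U, forall i, res F (hU i) t = s i.

Record sheaf (B : topologicalType) := Sheaf {
  sheaf_presheaf :> presheaf B;
  sheafP : is_sheaf sheaf_presheaf
}.

(* The convention, automatic for sheaves, that there is exactly one section
   over the empty set. *)
Definition is_normalized (B : topologicalType) (F : presheaf B) : Prop :=
  exists! s : F (opens0 B), True.

Record npresheaf (B : topologicalType) := NPresheaf {
  npresheaf_presheaf :> presheaf B;
  npresheafP : is_normalized npresheaf_presheaf
}.

Section PresheafOps.
Variable B : topologicalType.
Implicit Types (U V W : opens B) (F G P : presheaf B).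

Program Definition psh_prod (I : Type) (F : I -> presheaf B) : presheaf B :=
  @Presheaf B (fun U => forall i, F i U)
    (fun U V h s i => res (F i) h (s i)) _ _.
Next Obligation. by move=> I F U h s; apply: functional_extensionality_dep => i; exact: res_id. Qed.
Next Obligation. by move=> I F U V W h k l s; apply: functional_extensionality_dep => i; exact: res_comp. Qed.

Program Definition psh_coprod (I : Type) (F : I -> presheaf B) : presheaf B :=
  @Presheaf B (fun U => {i : I & F i U})
    (fun U V h s => existT _ (projT1 s) (res (F (projT1 s)) h (projT2 s))) _ _.
Next Obligation. by move=> I F U h [i s] /=; rewrite res_id. Qed.
Next Obligation. by move=> I F U V W h k l [i s] /=; rewrite (res_comp _ h k l). Qed.

(* Morphisms from the restriction of [F] to [U] to the restriction of [G]. *)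
Record hom_sec F G U := HomSec {
  hom_fun :> forall V, osub V U -> F V -> G V;
  hom_nat : forall V W (h : osub V U) (k : osub W V) (l : osub W U) (s : F V),
    hom_fun l (res F k s) = res G k (hom_fun h s)
}.

Lemma hom_sec_eq F G U (f g : hom_sec F G U) :
  (forall V h s, hom_fun f (V := V) h s = hom_fun g h s) -> f = g.
Proof.
case: f g => [f fn] [g gn] /= fg; have E : f = g.
  apply: functional_extensionality_dep => V.
  apply: functional_extensionality_dep => h.
  by apply: functional_extensionality_dep => s; exact: fg.
by subst g; congr HomSec; exact: Prop_irrelevance.
Qed.

Program Definition hom_res F G U V (h : osub V U) (f : hom_sec F G U) :
    hom_sec F G V :=
  @HomSec F G V (fun W k => hom_fun f (osub_trans k h)) _.
Next Obligation. by move=> *; exact: hom_nat. Qed.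

Program Definition psh_hom F G : presheaf B :=
  @Presheaf B (hom_sec F G) (@hom_res F G) _ _.
Next Obligation.
move=> F G U h f; apply: hom_sec_eq => V k s /=.
by congr (hom_fun f _ s); exact: Prop_irrelevance.
Qed.
Next Obligation.
move=> F G U V W h k l f; apply: hom_sec_eq => X m s /=.
by congr (hom_fun f _ s); exact: Prop_irrelevance.
Qed.

Program Definition psh_empty : presheaf B :=
  @Presheaf B (fun=> void) (fun _ _ _ s => s) _ _.
Next Obligation. by []. Qed.
Next Obligation. by []. Qed.

Definition pair_fam (T : Type) (x y : T) (b : bool) : T := if b then x else y.

(* The germ of [s] at [x], as the class of all sections defined near [x]
   that agree with [s] near [x]. *)
Definition germ P (x : B) V (s : P V) (p : {W : opens B & P W}) : Prop :=
  exists (O : opens B) (h : osub O V) (k : osub O (projT1 p)),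
    O x /\ res P h s = res P k (projT2 p).

Definition shf_local P U
    (sigma : forall x, U x -> {W : opens B & P W} -> Prop) : Prop :=
  forall x, U x -> exists (V : opens B) (h : osub V U) (s : P V),
    V x /\ forall y (hy : V y), sigma y (h y hy) = germ y s.

Definition shf_sec P U : Type :=
  {sigma : forall x, U x -> {W : opens B & P W} -> Prop | shf_local sigma}.

Lemma shf_sec_eq P U (f g : shf_sec P U) :
  (forall x (h : U x), sval f x h = sval g x h) -> f = g.
Proof.
case: f g => [f fP] [g gP] /= fg; have E : f = g.
  apply: functional_extensionality_dep => x.
  by apply: functional_extensionality_dep => h; exact: fg.
by subst g; congr exist; exact: Prop_irrelevance.
Qed.

Lemma germ_res P x V W (h : osub W V) (s : P V) :
  W x -> germ x (res P h s) = germ x s.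
Proof.
move=> Wx; apply: funext => -[X t]; apply: propext; split=> -[O [k [l [Ox e]]]].
  exists O, (osub_trans k h), l; split=> //.
  by rewrite -e (res_comp _ h k (osub_trans k h)).
exists (opensI O W), (@osubIr _ _ _), (osub_trans (@osubIl _ _ _) l).
split; first by [].
rewrite -(res_comp _ l (@osubIl _ O W)) -e.
rewrite (res_comp _ h (@osubIr _ O W) (osub_trans (@osubIl _ O W) k)).
by rewrite (res_comp _ k (@osubIl _ O W) (osub_trans (@osubIl _ O W) k)).
Qed.

Program Definition shf_res P U V (h : osub V U) (f : shf_sec P U) :
    shf_sec P V :=
  exist _ (fun x (hx : V x) => sval f x (h x hx)) _.
Next Obligation.
move=> P U V h [f fP] /= x Vx; have [W [k [s [Wx e]]]] := fP x (h x Vx).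
exists (opensI W V), (@osubIr _ _ _), (res P (@osubIl _ W V) s).
split; first by [].
move=> y Iy; rewrite germ_res // -(e y (osubIl _ _ y Iy)).
by congr (f y _); exact: Prop_irrelevance.
Qed.

Program Definition shf_presheaf P : presheaf B :=
  @Presheaf B (shf_sec P) (@shf_res P) _ _.
Next Obligation.
move=> P U h f; apply: shf_sec_eq => x Ux /=.
by congr (sval f x _); exact: Prop_irrelevance.
Qed.
Next Obligation.
move=> P U V W h k l f; apply: shf_sec_eq => x Ux /=.
by congr (sval f x _); exact: Prop_irrelevance.
Qed.

Lemma shf_is_sheaf P : is_sheaf (shf_presheaf P).
Proof.
move=> I U U_ hU cov s cmp.
have agree i j x (hi : U_ i x) (hj : U_ j x) : sval (s i) x hi = sval (s j) x hj.
  have /(f_equal (fun f => sval f x (conj hi hj))) /= := cmp i j.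
  rewrite (Prop_irrelevance (osubIl _ _ _ _) hi).
  by rewrite (Prop_irrelevance (osubIr _ _ _ _) hj).
pose idx x (Ux : U x) := sval (cid (cov x Ux)).
have idxP x (Ux : U x) : U_ (idx x Ux) x by exact: svalP (cid (cov x Ux)).
pose t x (Ux : U x) := sval (s (idx x Ux)) x (idxP x Ux).
have tP : shf_local t.
  move=> x Ux; have [i Ui] := cov x Ux.
  have [V [h [r [Vx e]]]] := svalP (s i) x Ui.
  exists V, (osub_trans h (hU i)), r; split=> // y Vy.
  by rewrite -(e y Vy); exact: agree.
exists (exist _ t tP); split=> [i|[t' t'P] tt'].
  by apply: shf_sec_eq => x Ux /=; exact: agree.
apply: shf_sec_eq => x Ux /=.
rewrite /t -(tt' (idx x Ux)) /=.
by congr (t' x _); exact: Prop_irrelevance.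
Qed.

Definition sheafify P : sheaf B := Sheaf (@shf_is_sheaf P).

Lemma shf_prod_is_sheaf (I : Type) (F : I -> sheaf B) : is_sheaf (psh_prod F).
Proof.
move=> J U U_ hU cov s cmp.
have H i : exists! t : F i U, forall j, res (F i) (hU j) t = s j i.
  apply: (@sheafP _ (F i)) => // j k.
  exact: (f_equal (fun f => f i) (cmp j k)).
exists (fun i => sval (cid (H i))); split=> [j|t' t'P].
  apply: functional_extensionality_dep => i /=.
  by case: (svalP (cid (H i))) => + _; exact.
apply: functional_extensionality_dep => i.
case: (svalP (cid (H i))) => _; apply => j.
by rewrite -t'P.
Qed.

Definition shf_prod (I : Type) (F : I -> sheaf B) : sheaf B :=
  Sheaf (@shf_prod_is_sheaf I F).

Definition shf_coprod (I : Type) (F : I -> sheaf B) : sheaf B :=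
  sheafify (psh_coprod F).

Lemma shf_hom_is_sheaf F (G : sheaf B) : is_sheaf (psh_hom F G).
Proof.
move=> I U U_ hU cov s cmp.
have agree i j V (hi : osub V (U_ i)) (hj : osub V (U_ j)) (r : F V) :
    s i V hi r = s j V hj r.
  have hij : osub V (opensI (U_ i) (U_ j)) by move=> x Vx; split; [exact: hi|exact: hj].
  have /(f_equal (fun f => hom_fun f hij r)) /= := cmp i j.
  rewrite (Prop_irrelevance (osub_trans _ _) hi).
  by rewrite (Prop_irrelevance (osub_trans _ _) hj).
pose c V i := opensI V (U_ i).
have H V (h : osub V U) (r : F V) :
    exists! t : G V, forall i, res G (@osubIl _ V (U_ i)) t =
      s i (c V i) (@osubIr _ V (U_ i)) (res F (@osubIl _ V (U_ i)) r).
  apply: (@sheafP _ G) => [x Vx|i j].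
    by have [i Ui] := cov x (h x Vx); exists i.
  set X := opensI _ _.
  have Xi : osub X (U_ i) by move=> x [[]].
  have Xj : osub X (U_ j) by move=> x [_ []].
  have XV : osub X V by move=> x [[]].
  rewrite -(hom_nat (s i) _ _ Xi) -(hom_nat (s j) _ _ Xj).
  rewrite !(res_comp F _ _ XV); exact: agree.
pose t V (h : osub V U) (r : F V) := sval (cid (H V h r)).
have tP V (h : osub V U) r i : res G (@osubIl _ V (U_ i)) (t V h r) =
    s i (c V i) (@osubIr _ V (U_ i)) (res F (@osubIl _ V (U_ i)) r).
  by case: (svalP (cid (H V h r))) => + _; exact.
have tU V (h : osub V U) r (g : G V) : (forall i, res G (@osubIl _ V (U_ i)) g =
    s i (c V i) (@osubIr _ V (U_ i)) (res F (@osubIl _ V (U_ i)) r)) -> t V h r = g.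
  by case: (svalP (cid (H V h r))) => _; exact.
have tN V W (h : osub V U) (k : osub W V) (l : osub W U) (r : F V) :
    t W l (res F k r) = res G k (t V h r).
  apply: tU => i.
  have cc : osub (c W i) (c V i) by move=> x [/k ? ?]; split.
  have cV : osub (c W i) V by move=> x [/k].
  rewrite (res_comp G _ _ cV) (res_comp F _ _ cV).
  rewrite -(res_comp G (@osubIl _ V (U_ i)) cc cV) tP.
  have cU : osub (c W i) (U_ i) by move=> x [].
  rewrite -(hom_nat (s i) _ _ cU) (res_comp F _ _ cV).
  exact: agree.
exists (HomSec tN); split=> [i|g gP].
  apply: hom_sec_eq => V h r /=; apply: tU => j.
  have cU : osub (c V j) (U_ i) by move=> x [/h].
  by rewrite -(hom_nat (s i) _ _ cU); exact: agree.
apply: hom_sec_eq => V h r /=; apply: tU => i.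
have cU : osub (c V i) U by move=> x [/h].
rewrite -(hom_nat g _ _ cU) -(gP i) /=.
by congr (hom_fun g _ _); exact: Prop_irrelevance.
Qed.

(* The presheaf [psh_hom F G] of morphisms between restrictions is already a
   sheaf, so it is the sheaf of germs of morphisms. *)
Definition shf_hom (F G : sheaf B) : sheaf B := Sheaf (@shf_hom_is_sheaf F G).

(* Characteristic presheaf of an open set [A]: over [U] it has one section (the
   proof of the inclusion) if [U] lies in [A], and none otherwise. *)
Program Definition psh_char (A : opens B) : presheaf B :=
  @Presheaf B (fun U => osub U A) (fun U V h s => osub_trans h s) _ _.
Next Obligation. by move=> *; exact: Prop_irrelevance. Qed.
Next Obligation. by move=> *; exact: Prop_irrelevance. Qed.

Lemma psh_char_is_sheaf (A : opens B) : is_sheaf (psh_char A).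
Proof.
move=> I U U_ hU cov s cmp.
have t : osub U A by move=> x /cov [i]; exact: s.
exists t; split=> [i|t' _]; last exact: (@Prop_irrelevance (osub U A)).
exact: (@Prop_irrelevance (osub (U_ i) A)).
Qed.

Definition shf_char (A : opens B) : sheaf B := Sheaf (@psh_char_is_sheaf A).

(* [P] with its set of sections over the empty set replaced by a point: the
   reflection of [P] into normalized presheaves. *)
Program Definition norm_presheaf P : presheaf B :=
  @Presheaf B (fun U => (exists x, U x) -> P U)
    (fun U V h s hV =>
       res P h (s (let: ex_intro x Vx := hV in ex_intro _ x (h x Vx)))) _ _.
Next Obligation.
move=> P U h s; apply: functional_extensionality_dep => hU; rewrite res_id.
by congr s; exact: Prop_irrelevance.
Qed.
Next Obligation.
move=> P U V W h k l s; apply: functional_extensionality_dep => hW.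
rewrite (res_comp _ h k l).
by congr (res P l (s _)); exact: Prop_irrelevance.
Qed.

Lemma norm_is_normalized P : is_normalized (norm_presheaf P).
Proof.
have t : norm_presheaf P (opens0 B) by move=> h; exfalso; case: h.
by exists t; split=> // t' _; apply: functional_extensionality_dep => -[].
Qed.

Definition normalize P : npresheaf B := NPresheaf (@norm_is_normalized P).

Lemma npsh_prod_normalized (I : Type) (F : I -> npresheaf B) :
  is_normalized (psh_prod F).
Proof.
exists (fun i => sval (cid (npresheafP (F i)))); split=> // t _.
apply: functional_extensionality_dep => i.
by case: (svalP (cid (npresheafP (F i)))) => _; exact.
Qed.

Definition npsh_prod (I : Type) (F : I -> npresheaf B) : npresheaf B :=
  NPresheaf (@npsh_prod_normalized I F).

Definition npsh_coprod (I : Type) (F : I -> npresheaf B) : npresheaf B :=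
  normalize (psh_coprod F).

Lemma npsh_hom_normalized F (G : npresheaf B) : is_normalized (psh_hom F G).
Proof.
have [g [_ gU]] := npresheafP G.
have E V (h : osub V (opens0 B)) : osub (opens0 B) V by [].
have U1 V (h : osub V (opens0 B)) (r r' : G V) : r = r'.
  rewrite -(res_id _ (osub_refl V) r) -(res_id _ (osub_refl V) r').
  rewrite -!(res_comp _ (E V h) h).
  by rewrite -(gU (res G (E V h) r)) // -(gU (res G (E V h) r')).
have n V W (h : osub V (opens0 B)) (k : osub W V) (l : osub W (opens0 B))
  (s : F V) : res G l g = res G k (res G h g) by exact: U1.
exists (HomSec (hom_fun := fun V h _ => res G h g) n); split=> // f _.
by apply: hom_sec_eq => V h s; exact: U1.
Qed.

Definition npsh_hom (F G : npresheaf B) : npresheaf B :=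
  NPresheaf (@npsh_hom_normalized F G).

Lemma npsh_char_normalized (A : opens B) : is_normalized (psh_char A).
Proof.
have t : psh_char A (opens0 B) by [].
by exists t; split=> // t' _; exact: (@Prop_irrelevance (osub (opens0 B) A)).
Qed.

Definition npsh_char (A : opens B) : npresheaf B :=
  NPresheaf (@npsh_char_normalized A).

End PresheafOps.

Definition local_valid (B : topologicalType) (D : Type)
    (A : (nat -> D) -> presheaf B) : Prop :=
  forall b : B, exists U : opens B,
    U b /\ forall mu : nat -> D, inhabited (A mu U).

(* Uniform covers in terms of entourages; only covers by open sets are needed,
   as the interiors of the members of a uniform cover form a uniform cover. *)
Definition uniform_cover (B : uniformType) (C : opens B -> Prop) : Prop :=
  exists E : set (B * B), entourage E /\
    forall b : B, exists U : opens B, C U /\ forall y, E (b, y) -> U y.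

Definition uniform_valid (B : uniformType) (D : Type)
    (A : (nat -> D) -> presheaf B) : Prop :=
  exists C : opens B -> Prop, uniform_cover C /\
    forall U : opens B, C U -> forall mu : nat -> D, inhabited (A mu U).

Definition sheaf_structure (B : topologicalType) (D : Type)
    (valid : ((nat -> D) -> presheaf B) -> Prop) : structure D :=
  {| obj := sheaf B;
     sbot := shf_char (opens0 B);
     sand F G := shf_prod (pair_fam F G);
     sor F G := shf_coprod (pair_fam F G);
     simp := @shf_hom B;
     sall := @shf_prod B D;
     sex := @shf_coprod B D;
     svalid A := valid (fun mu => A mu : presheaf B) |}.

(* Arbitrary functors from open sets to sets. The interpretation of [Bot] is the
   initial presheaf. It has no section over the empty set either, since
   otherwise there need be no morphism from it to an arbitrary presheaf. *)
Definition presheaf_structure (B : topologicalType) (D : Type)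
    (valid : ((nat -> D) -> presheaf B) -> Prop) : structure D :=
  {| obj := presheaf B;
     sbot := psh_empty B;
     sand F G := psh_prod (pair_fam F G);
     sor F G := psh_coprod (pair_fam F G);
     simp := @psh_hom B;
     sall := @psh_prod B D;
     sex := @psh_coprod B D;
     svalid := valid |}.

(* Presheaves with a single section over the empty set; [Bot] is, as for
   sheaves, the characteristic presheaf of the empty set. *)
Definition npresheaf_structure (B : topologicalType) (D : Type)
    (valid : ((nat -> D) -> presheaf B) -> Prop) : structure D :=
  {| obj := npresheaf B;
     sbot := npsh_char (opens0 B);
     sand F G := npsh_prod (pair_fam F G);
     sor F G := npsh_coprod (pair_fam F G);
     simp := @npsh_hom B;
     sall := @npsh_prod B D;
     sex := @npsh_coprod B D;
     svalid A := valid (fun mu => A mu : presheaf B) |}.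

Definition local_sheaf_structure (B : topologicalType) (D : Type) :=
  sheaf_structure (@local_valid B D).
Definition local_presheaf_structure (B : topologicalType) (D : Type) :=
  presheaf_structure (@local_valid B D).
Definition local_npresheaf_structure (B : topologicalType) (D : Type) :=
  npresheaf_structure (@local_valid B D).

Definition uniform_sheaf_structure (B : uniformType) (D : Type) :=
  sheaf_structure (@uniform_valid B D).
Definition uniform_presheaf_structure (B : uniformType) (D : Type) :=
  presheaf_structure (@uniform_valid B D).
Definition uniform_npresheaf_structure (B : uniformType) (D : Type) :=
  npresheaf_structure (@uniform_valid B D).

(* Main.v *)
Require Import Defs.
From mathcomp Require Import all_boot.
From mathcomp Require Import all_classical.
From mathcomp Require Import topology.

(** Fix an open set [U] and write [F <= G] when there is a morphism from the
    restriction of [F] to [U] to the restriction of [G]. In each of the three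
    structures this preorder is a Heyting prealgebra in which [sall] and [sex]
    are meets and joins: products and the exponential are computed sectionwise,
    while coproducts and the bottom object are reflections (sheafification or
    normalization), whose universal property still holds over [U]. Hence every
    law has a section over every [U], and the quantifier rules hold over each
    [U] separately. Modus ponens combines sections over two different covers,
    which have a common refinement both in the local and in the uniform case. *)

Set Implicit Arguments.
Unset Strict Implicit.
Unset Printing Implicit Defensive.

Local Open Scope classical_set_scope.

(** * Intuitionistic laws in a Heyting prealgebra *)

Record is_heyting (D : Type) (M : structure D)
    (le : obj M -> obj M -> Prop) : Prop := IsHeyting {
  hle_refl : forall a, le a a;
  hle_trans : forall b a c, le a b -> le b c -> le a c;
  hle_bot : forall a, le (sbot M) a;
  hle_and : forall a b c, le c (sand a b) <-> le c a /\ le c b;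
  hle_or : forall a b c, le (sor a b) c <-> le a c /\ le b c;
  hle_imp : forall a b c, le (sand a b) c <-> le a (simp b c);
  hle_all : forall (F : D -> obj M) c, le c (sall F) <-> forall d, le c (F d);
  hle_ex : forall (F : D -> obj M) c, le (sex F) c <-> forall d, le (F d) c
}.

Section Interpretation.
Variables (D : Type) (M : structure D) (v : valuation M).

Lemma scons_comp (d : D) (mu : nat -> D) (r : nat -> nat) :
  scons d mu \o scons 0 (S \o r) = scons d (mu \o r).
Proof. by apply: funext => -[]. Qed.

(** The induction keeps [r] and [mu] general because a binder changes both; [scons_comp] realigns
    them. *)
Lemma interp_rename (r : nat -> nat) (a : form) (mu : nat -> D) :
  interp v (rename r a) mu = interp v a (mu \o r).
Proof.
elim: a r mu => [k p x||a IHa b IHb|a IHa b IHb|a IHa b IHb|a IHa|a IHa] r mu //=.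
- by congr (v _ _); apply: val_inj; rewrite /= -map_comp.
- by rewrite IHa IHb.
- by rewrite IHa IHb.
- by rewrite IHa IHb.
- by congr sall; apply: funext => d; rewrite IHa scons_comp.
- by congr sex; apply: funext => d; rewrite IHa scons_comp.
Qed.

Lemma interp_inst (t : nat) (a : form) (mu : nat -> D) :
  interp v (inst t a) mu = interp v a (scons (mu t) mu).
Proof. by rewrite interp_rename; congr (interp v a); apply: funext => -[]. Qed.

Lemma interp_shift (a : form) (d : D) (mu : nat -> D) :
  interp v (shift a) (scons d mu) = interp v a mu.
Proof. by rewrite interp_rename. Qed.

Variables (le : obj M -> obj M -> Prop) (H : is_heyting le).

#[local] Lemma handl a b : le (sand a b) a.
Proof. by case/(hle_and H): (hle_refl H (sand a b)). Qed.

#[local] Lemma handr a b : le (sand a b) b.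
Proof. by case/(hle_and H): (hle_refl H (sand a b)). Qed.

#[local] Lemma horl a b : le a (sor a b).
Proof. by case/(hle_or H): (hle_refl H (sor a b)). Qed.

#[local] Lemma horr a b : le b (sor a b).
Proof. by case/(hle_or H): (hle_refl H (sor a b)). Qed.

#[local] Lemma hmp c a b : le c a -> le c (simp a b) -> le c b.
Proof.
move=> ca cab; apply: (hle_trans H (b := sand (simp a b) a)).
  exact/(hle_and H).
by apply/(hle_imp H); exact: (hle_refl H).
Qed.

#[local] Lemma hwkl a b c : le a c -> le (sand a b) c.
Proof. exact: (hle_trans H (handl a b)). Qed.

#[local] Lemma hwkr a b c : le b c -> le (sand a b) c.
Proof. exact: (hle_trans H (handr a b)). Qed.

#[local] Lemma himp_comm a b c : le a (simp b c) -> le b (simp a c).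
Proof.
move=> h; apply/(hle_imp H); apply: (hmp (handl b a)); exact: hwkr.
Qed.

(** Every law is an implication, so it can be checked as an inequality from antecedent to
    consequent, without a top element. *)
Lemma law_le (f : form) : law f ->
  exists a b, f = Imp a b /\ forall mu, le (interp v a mu) (interp v b mu).
Proof.
case=> [a b|a b c|a b|a b|a b|a b|a b|a b c|a|a t|a t];
  do 2 eexists; (split; first reflexivity) => mu /=.
- by apply/(hle_imp H); exact: handl.
- do 2 apply: (hle_imp H _ _ _).1.
  apply: (@hmp _ (interp v b mu)).
    by apply: (hmp (handr _ _)); apply: hwkl; exact: handr.
  by apply: (hmp (handr _ _)); apply: hwkl; exact: handl.
- exact: handl.
- exact: handr.
- by apply/(hle_imp H); exact: (hle_refl H).
- exact: horl.
- exact: horr.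
(* Exchanging antecedents puts the disjunction on the left of [le], where its universal property as
   a join applies. *)
- apply/(hle_imp H); apply: himp_comm; apply/(hle_or H).
  by split; apply: himp_comm; [exact: handl|exact: handr].
- exact: hle_bot.
- rewrite interp_inst.
  by move/(hle_all H): (hle_refl H (sall (fun d => interp v a (scons d mu)))).
- rewrite interp_inst.
  by move/(hle_ex H): (hle_refl H (sex (fun d => interp v a (scons d mu)))).
Qed.

End Interpretation.

(** * Morphisms of presheaves restricted to an open set *)

Section SheafSemantics.
Variable B : topologicalType.
Implicit Types (U V W : opens B) (F G K P : presheaf B).

Program Definition hom_id F U : hom_sec F F U := HomSec (hom_fun := fun _ _ s => s) _.
Next Obligation. by []. Qed.

Program Definition hom_comp F G K U (f : hom_sec F G U) (g : hom_sec G K U) :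
    hom_sec F K U :=
  HomSec (hom_fun := fun V h s => g V h (f V h s)) _.
Next Obligation. by move=> *; rewrite -hom_nat -hom_nat. Qed.

Program Definition hom_proj (I : Type) (F : I -> presheaf B) (i : I) U :
    hom_sec (psh_prod F) (F i) U := HomSec (hom_fun := fun _ _ s => s i) _.
Next Obligation. by []. Qed.

Program Definition hom_tuple (I : Type) (F : I -> presheaf B) G U
    (f : forall i, hom_sec G (F i) U) : hom_sec G (psh_prod F) U :=
  HomSec (hom_fun := fun V h s i => f i V h s) _.
Next Obligation.
by move=> *; apply: functional_extensionality_dep => i; exact: hom_nat.
Qed.

Program Definition hom_inj (I : Type) (F : I -> presheaf B) (i : I) U :
    hom_sec (F i) (psh_coprod F) U :=
  HomSec (hom_fun := fun _ _ s => existT _ i s) _.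
Next Obligation. by []. Qed.

Program Definition hom_cotuple (I : Type) (F : I -> presheaf B) G U
    (f : forall i, hom_sec (F i) G U) : hom_sec (psh_coprod F) G U :=
  HomSec (hom_fun := fun V h s => f (projT1 s) V h (projT2 s)) _.
Next Obligation. by move=> *; exact: hom_nat. Qed.

Definition bool_pair (F : bool -> presheaf B) U (a : F true U) (b : F false U) :
    psh_prod F U := fun i => if i then a else b.

Lemma bool_pair_res (F : bool -> presheaf B) U V (h : osub V U)
    (a : F true U) (b : F false U) :
  res (psh_prod F) h (bool_pair a b) = bool_pair (res _ h a) (res _ h b).
Proof. by apply: functional_extensionality_dep => -[]. Qed.

(** * The exponential adjunction *)

Section Curry.
Variables (F : bool -> presheaf B) (G : presheaf B) (U : opens B).

Program Definition curry_at (f : hom_sec (psh_prod F) G U) V (h : osub V U)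
    (a : F true V) : hom_sec (F false) G V :=
  HomSec (hom_fun := fun W k b =>
    f W (osub_trans k h) (bool_pair (res (F true) k a) b)) _.
Next Obligation.
move=> f V h a W X k l m b.
by rewrite -(hom_nat f _ _ (osub_trans m h)) bool_pair_res (res_comp _ k l m).
Qed.

Program Definition hom_curry (f : hom_sec (psh_prod F) G U) :
    hom_sec (F true) (psh_hom (F false) G) U :=
  HomSec (hom_fun := fun V h a => curry_at f h a) _.
Next Obligation.
move=> f V W h k l a; apply: hom_sec_eq => X m b /=.
rewrite (res_comp _ k m (osub_trans m k)).
by congr (hom_fun f _ _); exact: Prop_irrelevance.
Qed.

(** Evaluation: the morphism assigned to [s true] lives over [V] and is applied at the identity
    inclusion of [V]. *)
Program Definition hom_uncurry (f : hom_sec (F true) (psh_hom (F false) G) U) :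
    hom_sec (psh_prod F) G U :=
  HomSec (hom_fun := fun V h s => f V h (s true) V (osub_refl V) (s false)) _.
Next Obligation.
move=> f V W h k l s /=; rewrite (hom_nat f h k l) /=.
by rewrite -(hom_nat (f V h (s true)) _ _ (osub_trans (osub_refl W) k)).
Qed.

End Curry.

Lemma sheaf_eq_local (G : presheaf B) (I : Type) U (U_ : I -> opens B)
    (hU : forall i, osub (U_ i) U) (s t : G U) : is_sheaf G ->
  (forall x, U x -> exists i, U_ i x) ->
  (forall i, res G (hU i) s = res G (hU i) t) -> s = t.
Proof.
move=> Gsh cov st.
have [|r [_ ru]] := Gsh I U U_ hU cov (fun i => res G (hU i) t).
  move=> i j; have k : osub (opensI (U_ i) (U_ j)) U by move=> x [/hU].
  by rewrite !(res_comp _ _ _ k).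
by rewrite -(ru s st) -(ru t).
Qed.

(** The empty family, indexed by [void], covers the empty set. *)
Lemma sheaf_normalized (G : sheaf B) : is_normalized G.
Proof.
have [||t [_ tu]] := @sheafP _ G void (opens0 B) (fun=> opens0 B)
  (fun i => match i with end) _ (fun i => match i with end) _ => //.
by exists t; split=> // t' _; apply: tu => -[].
Qed.

(** A pointless [V] and [opens0 B] include each other, so restricting to [opens0 B] and back is the
    identity. *)
Lemma normalized_eq G V (r s : G V) :
  is_normalized G -> ~ (exists x, V x) -> r = s.
Proof.
move=> [g [_ gu]] V0.
have h : osub V (opens0 B) by move=> x Vx; apply: V0; exists x.
have k : osub (opens0 B) V by [].
rewrite -(res_id _ (osub_refl V) r) -(res_id _ (osub_refl V) s).
by rewrite -!(res_comp _ k h) -(gu (res G k r)) // -(gu (res G k s)).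
Qed.

(** A section [e] over [V] is a proof that [V] is empty; the section of [G] over the empty set is
    restricted along it. *)
Lemma hom_char0 G U : is_normalized G ->
  inhabited (hom_sec (psh_char (opens0 B)) G U).
Proof.
move=> [g _]; split.
apply: (HomSec (hom_fun := fun V _ (e : psh_char (opens0 B) V) => res G e g)).
by move=> V W h k l e; rewrite (res_comp _ e k (osub_trans k e)).
Qed.

(* All local representatives of a section of the sheafification. Gluing over all
   of them, rather than over chosen ones, makes naturality immediate. *)
Definition rep P V (s : shf_sec P V) : Type :=
  {W : opens B & {r : P W | exists h : osub W V,
    forall y (hy : W y), sval s y (h y hy) = germ y r}}.

Lemma rep_osub P V (s : shf_sec P V) (i : rep s) : osub (projT1 i) V.
Proof. by case: i => W [r re] /=; case: re. Qed.

Lemma rep_germ P V (s : shf_sec P V) (i : rep s) y (hy : projT1 i y)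
    (Vy : V y) : sval s y Vy = germ y (sval (projT2 i)).
Proof.
case: i hy => W [r re] /= hy; case: (re) => h e; rewrite -(e y hy).
by congr (sval s y _); exact: Prop_irrelevance.
Qed.

Lemma rep_cover P V (s : shf_sec P V) x :
  V x -> exists i : rep s, projT1 i x.
Proof.
move=> Vx; have [W [h [r [Wx e]]]] := svalP s x Vx.
have re : exists h : osub W V, forall y (hy : W y), sval s y (h y hy) = germ y r.
  by exists h.
by exists (existT _ W (exist _ r re)).
Qed.

Program Definition hom_unit P U : hom_sec P (shf_presheaf P) U :=
  HomSec (hom_fun := fun V _ s => exist _ (fun x _ => germ x s) _) _.
Next Obligation.
by move=> P U V _ s x Vx; exists V, (osub_refl V), s.
Qed.
Next Obligation.
by move=> P U V W h k l s; apply: shf_sec_eq => x Wx /=; exact: germ_res.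
Qed.

(** * The universal property of sheafification *)

Section Sheafify.
Variables (P : presheaf B) (G : sheaf B) (U : opens B) (f : hom_sec P G U).

Let img V (h : osub V U) (s : shf_sec P V) (i : rep s) : G (projT1 i) :=
  f _ (osub_trans (@rep_osub P V s i) h) (sval (projT2 i)).

(** Two representatives of [s] have equal germs on their overlap, hence coincide locally there; so
    do their images, and [G] is a sheaf. *)
Lemma sheafify_glue V (h : osub V U) (s : shf_sec P V) :
  exists! t : G V, forall i, res G (@rep_osub P V s i) t = img h i.
Proof.
apply: (@sheafP _ G) => [|i j]; first exact: rep_cover.
set X := opensI _ _.
(* All open subsets of the overlap on which the two representatives coincide; equality of germs
   makes them a cover. *)
pose O := {O : opens B & {h : osub O X | res P (osub_trans h (@osubIl _ _ _))
  (sval (projT2 i)) = res P (osub_trans h (@osubIr _ _ _)) (sval (projT2 j))}}.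
apply: (@sheaf_eq_local G O X (fun o => projT1 o) (fun o => sval (projT2 o))).
- exact: sheafP.
- move=> x [ix jx].
  have : germ x (sval (projT2 i)) (existT _ _ (sval (projT2 j))).
    rewrite -(rep_germ ix (rep_osub ix)) (rep_germ jx).
    by exists (projT1 j), (osub_refl _), (osub_refl _).
  move=> [W [k [l [Wx e]]]].
  have WX : osub W X by move=> y Wy; split; [exact: (k y Wy)|exact: (l y Wy)].
  suff e' : res P (osub_trans WX (@osubIl _ _ _)) (sval (projT2 i)) =
      res P (osub_trans WX (@osubIr _ _ _)) (sval (projT2 j)).
    by exists (existT _ W (exist _ WX e')).
  rewrite (Prop_irrelevance (osub_trans WX _) k) e.
  by congr res; exact: Prop_irrelevance.
- move=> [W [k e]] /=.
  rewrite (res_comp G _ _ (osub_trans k (@osubIl _ _ _))).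
  rewrite (res_comp G _ _ (osub_trans k (@osubIr _ _ _))).
  have WU : osub W U by move=> x Wx; have [/rep_osub/h] := k x Wx.
  by rewrite -!(hom_nat f _ _ WU) e.
Qed.

Let ext V (h : osub V U) (s : shf_sec P V) : G V :=
  sval (cid (sheafify_glue h s)).

Let ext_nat V W (h : osub V U) (k : osub W V) (l : osub W U) (s : shf_sec P V) :
  ext l (shf_res k s) = res G k (ext h s).
Proof.
rewrite /ext; case: cid => t [/= _ tu]; case: cid => t' [/= t'P _].
apply: tu => i.
(* A representative of the restriction of [s] to [W] also represents [s], so the gluing over [V]
   already prescribes its image. *)
have ie : exists h : osub (projT1 i) V, forall y (hy : projT1 i y),
    sval s y (h y hy) = germ y (sval (projT2 i)).
  exists (osub_trans (@rep_osub _ _ _ i) k) => y hy.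
  rewrite -(rep_germ hy (rep_osub hy)).
  by congr (sval s y _); exact: Prop_irrelevance.
pose j : rep s := existT _ (projT1 i) (exist _ (sval (projT2 i)) ie).
rewrite (res_comp G _ _ (@rep_osub _ _ _ j)) (t'P j) /img /=.
by congr (hom_fun f _ _); exact: Prop_irrelevance.
Qed.

Definition hom_sheafify : hom_sec (shf_presheaf P) G U :=
  @HomSec _ (shf_presheaf P) G U ext ext_nat.

End Sheafify.

(** * The universal property of normalization *)

Program Definition hom_norm P U : hom_sec P (norm_presheaf P) U :=
  HomSec (hom_fun := fun V _ s _ => s) _.
Next Obligation. by []. Qed.

Section Normalize.
Variables (P : presheaf B) (G : npresheaf B) (U : opens B) (f : hom_sec P G U).

(** Only a point of [V] turns [s] into a section of [P]; over an empty [V] the value is the one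
    section of [G]. *)
Let ext V (h : osub V U) (s : norm_presheaf P V) : G V :=
  match pselect (exists x, V x) with
  | left V0 => f V h (s V0)
  | right V0 => @res _ G (opens0 B) V (fun x Vx => V0 (ex_intro _ x Vx))
      (sval (cid (npresheafP G)))
  end.

Let ext_nat V W (h : osub V U) (k : osub W V) (l : osub W U)
    (s : norm_presheaf P V) : ext l (res _ k s) = res G k (ext h s).
Proof.
case: (pselect (exists x, W x)) => [[x Wx]|W0]; last first.
  by apply: normalized_eq => //; exact: npresheafP.
rewrite /ext; case: pselect => [W0|[]]; last by exists x.
case: pselect => [V0|[]]; last by exists x; exact: k.
rewrite -(hom_nat f h k l) /=; congr (hom_fun f _ (res P k (s _))).
exact: Prop_irrelevance.
Qed.

Definition hom_normalize : hom_sec (norm_presheaf P) G U :=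
  @HomSec _ (norm_presheaf P) G U ext ext_nat.

End Normalize.

Lemma hom_prodP (I : Type) (F : I -> presheaf B) G U :
  inhabited (hom_sec G (psh_prod F) U) <->
  forall i, inhabited (hom_sec G (F i) U).
Proof.
split=> [[f] i|f]; first by split; exact: hom_comp f (hom_proj F i U).
(* The components are chosen for all indices at once, by the axiom of choice. *)
by split; apply: hom_tuple => i; exact: inhabited_witness (f i).
Qed.

Lemma hom_coprodP (I : Type) (F : I -> presheaf B) G U :
  inhabited (hom_sec (psh_coprod F) G U) <->
  forall i, inhabited (hom_sec (F i) G U).
Proof.
split=> [[f] i|f]; first by split; exact: hom_comp (hom_inj F i U) f.
by split; apply: hom_cotuple => i; exact: inhabited_witness (f i).
Qed.

Lemma sheafify_homP (P : presheaf B) (G : sheaf B) U :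
  inhabited (hom_sec (shf_presheaf P) G U) <-> inhabited (hom_sec P G U).
Proof.
split=> -[f]; split; last exact: hom_sheafify.
exact: hom_comp (hom_unit P U) f.
Qed.

Lemma normalize_homP (P : presheaf B) (G : npresheaf B) U :
  inhabited (hom_sec (norm_presheaf P) G U) <-> inhabited (hom_sec P G U).
Proof.
split=> -[f]; split; last exact: hom_normalize.
exact: hom_comp (hom_norm P U) f.
Qed.

(** * Soundness for validity defined by covers *)

Record is_cover_validity (D : Type)
    (valid : ((nat -> D) -> presheaf B) -> Prop) : Prop := IsCoverValidity {
  valid_full : forall A : (nat -> D) -> presheaf B,
    (forall mu U, inhabited (A mu U)) -> valid A;
  valid_combine : forall A1 A2 A : (nat -> D) -> presheaf B,
    valid A1 -> valid A2 ->
    (forall U, (forall mu, inhabited (A1 mu U)) ->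
       (forall mu, inhabited (A2 mu U)) -> forall mu, inhabited (A mu U)) ->
    valid A
}.

Section Models.
Variables (D : Type) (M : structure D) (toP : obj M -> presheaf B).

(** [sor] and [sex] are fixed only by the morphisms out of them, which a reflection preserves;
    products and exponentials are the presheaf ones on the nose. *)
Record presheaf_semantics : Prop := PresheafSemantics {
  sem_bot : forall a U, inhabited (hom_sec (toP (sbot M)) (toP a) U);
  sem_and : forall a b, toP (sand a b) = psh_prod (fun i => toP (pair_fam a b i));
  sem_all : forall F : D -> obj M, toP (sall F) = psh_prod (fun d => toP (F d));
  sem_imp : forall a b, toP (simp a b) = psh_hom (toP a) (toP b);
  sem_or : forall a b c U, inhabited (hom_sec (toP (sor a b)) (toP c) U) <->
    inhabited (hom_sec (psh_coprod (fun i => toP (pair_fam a b i))) (toP c) U);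
  sem_ex : forall (F : D -> obj M) c U,
    inhabited (hom_sec (toP (sex F)) (toP c) U) <->
    inhabited (hom_sec (psh_coprod (fun d => toP (F d))) (toP c) U)
}.

Hypothesis sem : presheaf_semantics.

Lemma presheaf_heyting U :
  is_heyting (fun a b => inhabited (hom_sec (toP a) (toP b) U)).
Proof.
split.
- by move=> a; split; exact: hom_id.
- by move=> b a c [f] [g]; split; exact: hom_comp f g.
- by move=> a; exact: sem_bot.
- move=> a b c; rewrite (sem_and sem) hom_prodP.
  by split=> [f|[f g] []//]; split; [exact: (f true)|exact: (f false)].
- move=> a b c; rewrite (sem_or sem) hom_coprodP.
  by split=> [f|[f g] []//]; split; [exact: (f true)|exact: (f false)].
- move=> a b c; rewrite (sem_and sem) (sem_imp sem).
  split=> -[f]; split; first exact: hom_curry f.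
  by apply: hom_uncurry; exact: f.
- by move=> F c; rewrite (sem_all sem) hom_prodP.
- by move=> F c; rewrite (sem_ex sem) hom_coprodP.
Qed.

Variable valid : ((nat -> D) -> presheaf B) -> Prop.
Hypothesis validM : forall A, svalid A <-> valid (fun mu => toP (A mu)).
Hypothesis covP : is_cover_validity valid.

Lemma presheaf_semantics_model : is_model M.
Proof.
split=> [v f lf|v ps c].
  apply/validM; apply: (valid_full covP) => mu U.
  have [a [b [-> ab]]] := law_le v (presheaf_heyting U) lf.
  by rewrite /= (sem_imp sem); exact: ab.
case=> {ps c} [a b|a c|a c] Hps.
- have [/validM Ha Hps1] := proj1 (List.Forall_cons_iff _ _ _) Hps.
  have [/validM Hab _] := proj1 (List.Forall_cons_iff _ _ _) Hps1.
  apply/validM; apply: (valid_combine covP Ha Hab) => U sa sab mu.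
  have [s] := sa mu; move: (sab mu); rewrite /= (sem_imp sem) => -[f].
  by split; exact: f U (osub_refl U) s.
- have [/validM H _] := proj1 (List.Forall_cons_iff _ _ _) Hps.
  (* The one premiss fills both slots. Its [U] serves all assignments, so [s] may be used at
     [scons d mu] for every [d] over the same [U]. *)
  apply/validM; apply: (valid_combine covP H H) => U s _ mu.
  rewrite /= (sem_imp sem); apply/(hle_all (presheaf_heyting U)) => d.
  by have := s (scons d mu); rewrite /= (sem_imp sem) interp_shift.
- have [/validM H _] := proj1 (List.Forall_cons_iff _ _ _) Hps.
  apply/validM; apply: (valid_combine covP H H) => U s _ mu.
  rewrite /= (sem_imp sem); apply/(hle_ex (presheaf_heyting U)) => d.
  by have := s (scons d mu); rewrite /= (sem_imp sem) interp_shift.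
Qed.

End Models.

(** * The sheaf, presheaf and normalized presheaf structures *)

Section Structures.
Variables (D : Type) (valid : ((nat -> D) -> presheaf B) -> Prop).

Lemma sheaf_structure_semantics :
  @presheaf_semantics D (sheaf_structure valid) (@sheaf_presheaf B).
Proof.
split=> //=.
- by move=> G U; apply: hom_char0; exact: sheaf_normalized.
- by move=> F G K U; exact: sheafify_homP.
- by move=> F G U; exact: sheafify_homP.
Qed.

Lemma presheaf_structure_semantics :
  @presheaf_semantics D (presheaf_structure valid) (fun F => F).
Proof.
split=> //= G U; split.
apply: (HomSec (hom_fun := fun V _ (e : psh_empty B V) => match e with end)).
by move=> ? ? ? ? ? [].
Qed.

Lemma npresheaf_structure_semantics :
  @presheaf_semantics D (npresheaf_structure valid) (@npresheaf_presheaf B).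
Proof.
split=> //=.
- by move=> G U; apply: hom_char0; exact: npresheafP.
- by move=> F G K U; exact: normalize_homP.
- by move=> F G U; exact: normalize_homP.
Qed.

Hypothesis covP : is_cover_validity valid.

Lemma structures_model :
  is_model (sheaf_structure valid) /\ is_model (presheaf_structure valid) /\
  is_model (npresheaf_structure valid).
Proof.
split; [|split].
- exact: (presheaf_semantics_model sheaf_structure_semantics (valid := valid)).
- exact: (presheaf_semantics_model presheaf_structure_semantics (valid := valid)).
- exact: (presheaf_semantics_model npresheaf_structure_semantics (valid := valid)).
Qed.

End Structures.
End SheafSemantics.

(** * Common refinements of local and of uniform covers *)

Lemma inhabited_res (B : topologicalType) (F : presheaf B) (U V : opens B) :
  osub V U -> inhabited (F U) -> inhabited (F V).
Proof. by move=> h [s]; split; exact: (res F h s). Qed.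

Lemma local_cover_validity (B : topologicalType) (D : Type) :
  is_cover_validity (@local_valid B D).
Proof.
split=> [A sA b|A1 A2 A v1 v2 h b]; first by exists (Opens openT); split.
have [U [Ub s1]] := v1 b; have [V [Vb s2]] := v2 b.
exists (opensI U V); split=> //; apply: h => mu.
  exact: inhabited_res (@osubIl _ U V) (s1 mu).
exact: inhabited_res (@osubIr _ U V) (s2 mu).
Qed.

Lemma uniform_cover_validity (B : uniformType) (D : Type) :
  is_cover_validity (@uniform_valid B D).
Proof.
split=> [A sA|A1 A2 A].
  exists (fun=> True); split=> //.
  exists setT; split; first exact: entourageT.
  by move=> b; exists (Opens openT).
move=> [C1 [[E1 [entE1 c1]] s1]] [C2 [[E2 [entE2 c2]] s2]] h.
(* Pairwise intersections of members of the two covers; the entourage [E1]&[E2] witnesses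
   uniformity. *)
exists (fun W => exists U V, [/\ C1 U, C2 V & W = opensI U V]); split.
  exists (E1 `&` E2); split; first exact: filterI.
  move=> b; have [U [CU EU]] := c1 b; have [V [CV EV]] := c2 b.
  exists (opensI U V); split; first by exists U, V.
  by move=> y [/EU ? /EV].
move=> _ [U [V [CU CV ->]]]; apply: h => mu.
  exact: inhabited_res (@osubIl _ U V) (s1 U CU mu).
exact: inhabited_res (@osubIr _ U V) (s2 V CV mu).
Qed.

Theorem theorem6p25 :
  (forall (B : topologicalType) (D : Type), inhabited D ->
     is_model (local_sheaf_structure B D) /\
     is_model (local_presheaf_structure B D) /\
     is_model (local_npresheaf_structure B D)) /\
  (forall (B : uniformType) (D : Type), inhabited D ->
     is_model (uniform_sheaf_structure B D) /\
     is_model (uniform_presheaf_structure B D) /\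
     is_model (uniform_npresheaf_structure B D)).
Proof.
split=> B D _; apply: structures_model.
  exact: local_cover_validity.
exact: uniform_cover_validity.
Qed.
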